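(* Let $m$ and $n$ be composite integers. Then the proper divisor graphs $\Upsilon_m$ and $\Upsilon_n$ are isomorphic if and only if either $m$ and $n$ are similar, or $\{m,n\}=\{p^3, q_1q_2\}$ for some primes $p,q_1,q_2$ with $q_1\neq q_2$ (in this exceptional case $\Upsilon_m\cong\Upsilon_n$ although $m,n$ are not similar).
   Context: For an integer $n>1$, a proper divisor of $n$ is an integer $d$ with $1<d<n$ and $d\mid n$. The proper divisor graph $\Upsilon_n$ is the simple graph whose vertices are the proper divisors of $n$, two distinct vertices $u,v$ being adjacent iff $n$ divides $uv$. Two positive integers $n=p_1^{\alpha_1}\cdots p_k^{\alpha_k}$ and $m=q_1^{\beta_1}\cdots q_l^{\beta_l}$ (prime power factorizations with distinct primes in each, $\alpha_1\ge\cdots\ge\alpha_k\ge1$, $\beta_1\ge\cdots\ge\beta_l\ge1$) are called similar if $k=l$ and $\alpha_i=\beta_i$ for all $i$. *)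

(* Defs.v *)
From HB Require Import structures.
From mathcomp Require Import all_boot.

Set Implicit Arguments.
Unset Strict Implicit.
Unset Printing Implicit Defensive.

Definition composite (n : nat) : bool := (1 < n) && ~~ prime n.

Record sgraph : Type := SGraph {
  vertex : finType;
  adj : rel vertex;
  adj_sym : symmetric adj;
  adj_irrefl : irreflexive adj
}.

Definition graph_iso (G H : sgraph) : Prop :=
  exists f : vertex G -> vertex H,
    bijective f /\ forall u v : vertex G, adj (f u) (f v) = adj u v.

(* The bound d < n is carried by the type 'I_n. *)
Definition proper_divisor (n : nat) : finType :=
  {d : 'I_n | (1 < d) && (d %| n)}.

Definition pdg_adj (n : nat) : rel (proper_divisor n) :=
  fun u v => (u != v) && (n %| val u * val v).

Lemma pdg_adj_sym (n : nat) : symmetric (@pdg_adj n).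
Proof. by move=> u v; rewrite /pdg_adj eq_sym mulnC. Qed.

Lemma pdg_adj_irrefl (n : nat) : irreflexive (@pdg_adj n).
Proof. by move=> u; rewrite /pdg_adj eqxx. Qed.

Definition proper_divisor_graph (n : nat) : sgraph :=
  SGraph (@pdg_adj_sym n) (@pdg_adj_irrefl n).

(* s lists the pairs (p_i, alpha_i) of n = p_1 ^ alpha_1 ... p_k ^ alpha_k,
   with alpha_1 >= ... >= alpha_k >= 1. *)
Definition ordered_factorization (n : nat) (s : seq (nat * nat)) : Prop :=
  [/\ uniq (unzip1 s),
      all prime (unzip1 s),
      sorted geq (unzip2 s),
      all (leq 1) (unzip2 s)
    & n = \prod_(f <- s) f.1 ^ f.2].

Definition similar (m n : nat) : Prop :=
  exists s t : seq (nat * nat),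
    [/\ ordered_factorization m s,
        ordered_factorization n t
      & unzip2 s = unzip2 t].

(* {m, n} = {p ^ 3, q1 * q2} as unordered pairs. *)
Definition exceptional_pair (m n : nat) : Prop :=
  exists p q1 q2 : nat,
    [/\ prime p, prime q1, prime q2, q1 <> q2
      & (m = p ^ 3 /\ n = q1 * q2) \/ (m = q1 * q2 /\ n = p ^ 3)].

(* Main.v *)
(** Put [T = tau n]; the graph of [n] has [T - 2] vertices.  The vertices [v] with
    [n %| u * v] are the multiples of [n %/ u], so [u] has degree
    [tau u - 1 - [n %| u ^ 2]].  If [T > 5], the vertices of degree one are therefore
    exactly the primes [p] dividing [n].  The only neighbour of [p] is [n %/ p], whose
    degree is [a * T / (a + 1) - 1 - [a > 1]] with [a = logn p n].  For [T > 6] this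
    expression is injective in the [a] with [a + 1 %| T], so the graph determines the
    multiset of exponents.  For [T <= 6] the exponents have product of successors [T];
    besides the exceptional [T = 4], only [T = 6] (exponents [5] or [1, 2]) is
    ambiguous, and there the number of vertices of degree one decides.  Conversely,
    a bijection of primes preserving exponents carries divisors to divisors. *)

Require Import Defs.
From HB Require Import structures.
From mathcomp Require Import all_boot.
From mathcomp Require Import zify.

Set Implicit Arguments.
Unset Strict Implicit.
Unset Printing Implicit Defensive.

(** * The number of divisors and its multiplicativity *)

Definition tau (n : nat) : nat := size (divisors n).

(** Coprimality gives both halves: from [x * y = x' * y'], [x] is coprime to [y'] and so divides
    [x'], and conversely; a divisor [d] of the product splits as [gcdn d m * gcdn d n]. *)
Lemma perm_divisors_coprime (m n : nat) : 0 < m -> 0 < n -> coprime m n ->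
  perm_eq (divisors (m * n)) [seq d * e | d <- divisors m, e <- divisors n].
Proof.
move=> m0 n0 co; apply: uniq_perm; first exact: divisors_uniq.
  apply: allpairs_uniq; rewrite ?divisors_uniq //.
  move=> [d e] [d' e'] /allpairsP[[x y] /= [xm yn [-> ->]]].
  move=> /allpairsP[[x' y'] /= [xm' yn' [-> ->]]] E.
  move: xm yn xm' yn'; rewrite -!dvdn_divisors // => xm yn xm' yn'.
  have coxy u v : u %| m -> v %| n -> coprime u v.
    by move=> um vn; apply: coprime_dvdl um _; apply: coprime_dvdr vn _.
  have Ex : x = x'.
    apply/eqP; rewrite eqn_dvd -(Gauss_dvdl x' (coxy _ _ xm yn')) -E.
    rewrite dvdn_mulr //= -(Gauss_dvdl x (coxy _ _ xm' yn)) E.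
    by rewrite dvdn_mulr.
  have x0 : 0 < x by apply: dvdn_gt0 xm.
  by move/eqP: E; rewrite -Ex eqn_pmul2l // => /eqP ->.
move=> d; rewrite -dvdn_divisors ?muln_gt0 ?m0 //.
apply/idP/allpairsP => [dmn | [[x y] /= []]]; last first.
  by rewrite -!dvdn_divisors // => xm yn ->; apply: dvdn_mul.
exists (gcdn d m, gcdn d n); rewrite /= -!dvdn_divisors // !dvdn_gcdr; split=> //.
apply/eqP; rewrite eqn_dvd; apply/andP; split.
  by rewrite muln_gcdl !muln_gcdr !dvdn_gcd dmn !(dvdn_mulr _ (dvdnn d)) (dvdn_mull _ (dvdnn d)).
rewrite Gauss_dvd ?dvdn_gcdl //.
by apply: coprime_dvdl (dvdn_gcdr _ _) _; apply: coprime_dvdr (dvdn_gcdr _ _) _.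
Qed.

Lemma tau_coprime (m n : nat) : 0 < m -> 0 < n -> coprime m n ->
  tau (m * n) = tau m * tau n.
Proof.
by move=> m0 n0 /(perm_divisors_coprime m0 n0)/perm_size; rewrite size_allpairs.
Qed.

Lemma tau_pfactor (p a : nat) : prime p -> tau (p ^ a) = a.+1.
Proof.
move=> pp; have /perm_size : perm_eq (divisors (p ^ a)) [seq p ^ i | i <- iota 0 a.+1].
  apply: uniq_perm; first exact: divisors_uniq.
    rewrite map_inj_uniq ?iota_uniq // => i j /eqP.
    by rewrite eqn_exp2l ?prime_gt1 // => /eqP.
  move=> d; rewrite -dvdn_divisors ?expn_gt0 ?prime_gt0 //.
  apply/(dvdn_pfactor _ _ pp)/mapP => [[i ia ->]|[i]].
    by exists i => //; rewrite mem_iota.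
  by rewrite mem_iota => ia ->; exists i.
by rewrite size_map size_iota.
Qed.

Lemma tau_prime (p : nat) : prime p -> tau p = 2.
Proof. by move=> pp; rewrite -{1}[p]expn1 tau_pfactor. Qed.

Lemma leq_tau (d n : nat) : 0 < n -> d %| n -> tau d <= tau n.
Proof.
move=> n0 dn; apply: uniq_leq_size; first exact: divisors_uniq.
move=> e; rewrite -!dvdn_divisors ?(dvdn_gt0 _ dn) //.
by move=> ed; apply: dvdn_trans dn.
Qed.

Lemma uniq_divisors_leq_tau (s : seq nat) (n : nat) : 0 < n -> uniq s ->
  all (dvdn^~ n) s -> size s <= tau n.
Proof.
move=> n0 us /allP sn; apply: uniq_leq_size => // d /sn.
by rewrite -dvdn_divisors.
Qed.

(** Otherwise [1], the least prime factor and [n] are three distinct divisors. *)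
Lemma tau2_prime (n : nat) : 1 < n -> tau n <= 2 -> prime n.
Proof.
move=> n1; apply: contraLR => pn; rewrite -ltnNge.
have pp := pdiv_prime n1; have pl := prime_gt1 pp.
apply: (@uniq_divisors_leq_tau [:: 1; pdiv n; n]); rewrite ?(ltnW n1) //=.
  rewrite !inE !andbT negb_or -andbA; apply/and3P; split; [lia|lia|].
  by apply: contraNneq pn => <-.
by rewrite dvd1n pdiv_dvd dvdnn.
Qed.

(** With [n = c * p] and [p] the least prime factor, [c <> p] would make [1], [p], [c], [n] four
    distinct divisors. *)
Lemma tau3_square (n : nat) : 1 < n -> tau n = 3 ->
  exists2 p, prime p & n = p ^ 2.
Proof.
move=> n1 tn; have n0 := ltnW n1; have pp := pdiv_prime n1.
have pl := prime_gt1 pp; exists (pdiv n) => //.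
set p := pdiv n in pp pl *.
have pn : p %| n := pdiv_dvd n.
have En := divnK pn; set c := n %/ p in En.
have cn : c %| n by rewrite -En dvdn_mulr.
rewrite -En; case: (eqVneq c p) => [-> //|cp].
have npr : ~~ prime n by apply/negP => /tau_prime; rewrite tn.
have c1 : 1 < c.
  case: (ltngtP c 1) => // c1; first by move: c1 En; case: (c) => //; lia.
  by move: npr; rewrite -En c1 mul1n pp.
have: 3 < tau n; last by rewrite tn.
apply: (@uniq_divisors_leq_tau [:: 1; p; c; n]) => //=.
  have [ppn cpn] : p < n /\ c < n by split; nia.
  by rewrite !inE; apply/and4P; split=> //; lia.
by rewrite dvd1n pn cn dvdnn.
Qed.

Lemma tau_logn (p n : nat) : 0 < n -> prime p ->
  tau n = (logn p n).+1 * (tau n %/ (logn p n).+1).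
Proof.
move=> n0 pp; have [n' co En] := pfactor_coprime pp n0.
have n'0 : 0 < n' by move: n0; rewrite En muln_gt0 => /andP[].
suff -> : tau n = tau n' * (logn p n).+1 by rewrite mulnK // mulnC.
have p0 := prime_gt0 pp.
by rewrite {1}En tau_coprime ?tau_pfactor ?expn_gt0 ?p0 // coprime_sym coprimeXl.
Qed.

(** If [n = n' * p ^ a] with [n'] prime to [p], the quotient on the right is [tau n'], and dividing
    [n] by [p] only lowers the factor [a.+1] to [a]. *)
Lemma tau_divp (p n : nat) : 0 < n -> prime p -> p %| n ->
  tau (n %/ p) = logn p n * (tau n %/ (logn p n).+1).
Proof.
move=> n0 pp pn; have [n' co En] := pfactor_coprime pp n0.
have n'0 : 0 < n' by move: n0; rewrite En muln_gt0 => /andP[].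
have p0 := prime_gt0 pp.
have co' i : coprime n' (p ^ i) by rewrite coprime_sym coprimeXl.
have Et : tau n = tau n' * (logn p n).+1.
  by rewrite {1}En tau_coprime ?tau_pfactor ?expn_gt0 ?p0.
have a0 : 0 < logn p n by rewrite logn_gt0 mem_primes pp n0.
rewrite Et mulnK // {1}En -[in p ^ _](prednK a0) expnSr mulnA mulnK //.
by rewrite tau_coprime ?tau_pfactor ?expn_gt0 ?p0 // prednK // mulnC.
Qed.

Lemma tau_exponents (n : nat) : 0 < n ->
  tau n = \prod_(a <- unzip2 (prime_decomp n)) a.+1.
Proof.
move=> n0; rewrite {1}(prod_prime_decomp n0) prime_decompE.
have: {subset primes n <= prime} by move=> p; rewrite mem_primes => /andP[].
(* The exponents remain [logn p n] for the original [n]; only the list of primes is generalized for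
   the induction. *)
move: (primes n) (primes_uniq n) => s us sp; rewrite /unzip2 -map_comp !big_map /=.
elim: s us sp => [|p s IH] /=; first by rewrite !big_nil.
case/andP=> ps us sp; rewrite !big_cons.
have pp : prime p by apply: sp; rewrite mem_head.
have sp' : {subset s <= prime} by move=> q qs; apply: sp; rewrite inE qs orbT.
have p0 := prime_gt0 pp.
rewrite -IH // tau_coprime ?tau_pfactor ?expn_gt0 ?p0 //.
  by rewrite big_seq prodn_cond_gt0 // => q /sp' /prime_gt0 q0; rewrite expn_gt0 q0.
rewrite big_seq; apply: (big_ind (coprime _)) => [|x y|q qs].
- exact: coprimen1.
- by rewrite coprimeMr => -> ->.
- apply/coprimeXl/coprimeXr; rewrite prime_coprime // dvdn_prime2 //; last exact: sp'.
  by apply: contraNneq ps => ->.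
Qed.

(** * Vertices and degrees in the proper divisor graph *)

Lemma composite_gt1 (n : nat) : composite n -> 1 < n.
Proof. by case/andP. Qed.

Lemma composite_tau (n : nat) : composite n -> 2 < tau n.
Proof.
case/andP=> n1; apply: contraNltn; exact: tau2_prime.
Qed.

Lemma proper_divisorP (n : nat) (u : vertex (proper_divisor_graph n)) :
  [/\ 1 < val (val u), val (val u) < n & val (val u) %| n].
Proof. by case: u => [[d dn] /= /andP[]]; split. Qed.

Lemma vertex_of_divisor (n d : nat) : 1 < d -> d < n -> d %| n ->
  exists u : vertex (proper_divisor_graph n), val (val u) = d.
Proof.
move=> d1 dn dd; have dP : (1 < Ordinal dn) && (Ordinal dn %| n) by rewrite /= d1.
by exists (exist _ (Ordinal dn) dP).
Qed.

(** Passes between counting over all divisors and over vertices: the divisors are the vertices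
    together with [1] and [n], which differ because [1 < n]. *)
Lemma card_proper_divisors (n : nat) (P : pred nat) : 1 < n ->
  count P (divisors n) =
    P 1 + P n + #|[set u : proper_divisor n | P (val (val u))]|.
Proof.
move=> n1; have n0 := ltnW n1.
pose s := [seq val (val u) | u : proper_divisor n].
have us : uniq s.
  by rewrite map_inj_uniq ?enum_uniq // => u v /val_inj/val_inj.
have: perm_eq (divisors n) [:: 1, n & s].
  apply: uniq_perm; first exact: divisors_uniq.
    rewrite /= us andbT inE negb_or neq_ltn n1 /=; apply/andP; split.
      by apply/negP => /mapP[u _ E]; have [] := proper_divisorP u; rewrite -E.
    by apply/negP => /mapP[u _ E]; have [_] := proper_divisorP u; rewrite -E ltnn.
  move=> d; rewrite -dvdn_divisors // !inE.
  apply/idP/or3P => [dn | [/eqP->|/eqP->|/mapP[u _ ->]]]; rewrite ?dvd1n //; last first.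
    by have [] := proper_divisorP u.
  have [->|d1] := eqVneq d 1; first by constructor 1.
  have [->|dn1] := eqVneq d n; first by constructor 2.
  constructor 3.
  have d0 := dvdn_gt0 n0 dn; have dln : d < n by rewrite ltn_neqAle dn1 dvdn_leq.
  have dl1 : 1 < d by lia.
  have [u <-] := vertex_of_divisor dl1 dln dn.
  by apply/mapP; exists u => //; rewrite mem_enum.
move/permP=> ->; rewrite /= addnA; congr (_ + _).
rewrite /s count_map -size_filter cardE; congr size.
by rewrite -filter_predI; apply: eq_filter => u; rewrite !inE andbT.
Qed.

Lemma card_vertices (n : nat) : 1 < n ->
  tau n = #|vertex (proper_divisor_graph n)|.+2.
Proof.
move=> n1; rewrite /tau -(count_predT (divisors n)) card_proper_divisors //.
by rewrite cardsE; congr (_.+2); apply: eq_card.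
Qed.

Definition degree (G : sgraph) (u : vertex G) : nat := #|[set v | adj u v]|.

(* The divisors [v] of [n] with [n %| u * v] are the multiples of [n %/ u]. *)
Lemma count_codivisors (n u : nat) : 0 < n -> u %| n ->
  count (fun v => n %| u * v) (divisors n) = tau u.
Proof.
move=> n0 un; have u0 := dvdn_gt0 n0 un; have En := divnK un.
have c0 : 0 < n %/ u by rewrite divn_gt0 // dvdn_leq.
rewrite -size_filter /tau -(size_map (muln (n %/ u)) (divisors u)); apply: perm_size.
apply: uniq_perm; first by rewrite filter_uniq ?divisors_uniq.
  rewrite map_inj_uniq ?divisors_uniq // => i j /eqP.
  by rewrite eqn_pmul2l // => /eqP.
move=> v; rewrite mem_filter -dvdn_divisors //.
apply/andP/mapP => [[nuv vn]|[e]].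
  have cv : n %/ u %| v by rewrite -(dvdn_pmul2l u0) mulnC En.
  exists (v %/ (n %/ u)); last by rewrite mulnC divnK.
  by rewrite -dvdn_divisors // -(dvdn_pmul2r c0) divnK // mulnC En.
rewrite -dvdn_divisors // => eu ->.
by rewrite mulnA (mulnC u) En dvdn_mulr //= -{2}En dvdn_pmul2l.
Qed.

(** Of the [tau u] divisors [v] with [n %| u * v], the vertex graph loses [n] itself, and also [u]
    when [n %| u ^ 2], since there are no loops; [1] is not among them because [u < n]. *)
Lemma degree_tau (n : nat) (u : vertex (proper_divisor_graph n)) :
  degree u + (n %| val (val u) ^ 2) + 1 = tau (val (val u)).
Proof.
have [u1 un du] := proper_divisorP u; have n1 := ltn_trans u1 un.
have n0 := ltnW n1; rewrite -(count_codivisors n0 du) card_proper_divisors //.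
rewrite muln1 (gtnNdvd _ un) ?(ltnW u1) // dvdn_mull // add0n addnC; congr (_ + _).
rewrite /degree [RHS](cardsD1 u) inE addnC -mulnn; congr (_ + _).
by apply: eq_card => v; rewrite !inE /= /pdg_adj eq_sym.
Qed.

(** * Vertices of degree one and their neighbours *)

Section Leaves.

Variable n : nat.
Hypothesis n_gt1 : 1 < n.
Hypothesis tau_gt5 : 5 < tau n.

Let n_gt0 : 0 < n := ltnW n_gt1.

(** Degree one means [tau d] is [2] or [3]. The value [3] occurs only if [n %| d ^ 2] with
    [d = p ^ 2], that is, [n %| p ^ 4]. *)
Lemma leaf_prime (u : vertex (proper_divisor_graph n)) :
  (degree u == 1) = prime (val (val u)).
Proof.
have [u1 un du] := proper_divisorP u; have dt := degree_tau u.
set d := val (val u) in u1 un du dt *.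
(* This is where the bound [5] comes from: [p ^ 4] has exactly five divisors. *)
have Nsq p : prime p -> ~~ (n %| p ^ 4).
  move=> pp; apply: contraL tau_gt5 => /leq_tau; rewrite tau_pfactor // => H.
  by rewrite -leqNgt H // expn_gt0 prime_gt0.
apply/eqP/idP => [E|pd]; move: dt; last first.
  rewrite tau_prime // (negbTE (_ : ~~ (n %| d ^ 2))) ?addn0; first by lia.
  by apply: contra (Nsq _ pd) => /dvdn_trans; apply; rewrite dvdn_exp2l.
rewrite E; have [nd|_] := boolP (n %| _) => /esym td; last by apply: tau2_prime; rewrite // td.
have [p pp Ed] := tau3_square u1 td.
by case/negP: (Nsq p pp); rewrite (expnM p 2 2) -Ed.
Qed.

Lemma prime_vertex (p : nat) : p \in primes n ->
  exists u : vertex (proper_divisor_graph n), val (val u) = p.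
Proof.
rewrite mem_primes => /and3P[pp _ pn].
have pln : p < n.
  rewrite ltn_neqAle dvdn_leq // andbT.
  by apply: contraL tau_gt5 => /eqP <-; rewrite tau_prime.
by apply: vertex_of_divisor; rewrite ?prime_gt1.
Qed.

Lemma codivisor_vertex (u : vertex (proper_divisor_graph n)) :
  exists v : vertex (proper_divisor_graph n), val (val v) = n %/ val (val u).
Proof.
have [u1 un du] := proper_divisorP u.
apply: vertex_of_divisor; rewrite ?ltn_Pdiv ?dvdn_div //.
by rewrite ltn_divRL // mul1n.
Qed.

(** The degree of the vertex [n %/ p] when [T = tau n] and [a = logn p n]: the product is
    [tau (n %/ p)], and the last term records whether [n] divides the square of [n %/ p]. *)
Definition exponent_code (T a : nat) : nat := a * (T %/ a.+1) - 1 - (1 < a).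

Lemma leaf_neighbor_degree (u : vertex (proper_divisor_graph n)) :
  prime (val (val u)) ->
  \sum_(v | adj u v) degree v = exponent_code (tau n) (logn (val (val u)) n).
Proof.
move=> pu; have [u1 un du] := proper_divisorP u; have [v Ev] := codivisor_vertex u.
set p := val (val u) in pu u1 un du Ev *.
have En := divnK du.
(* This keeps [p] and [n %/ p] distinct, so that they really are adjacent. *)
have npp : ~~ (n %| p ^ 2).
  apply: contraL tau_gt5 => /leq_tau; rewrite tau_pfactor // expn_gt0 (ltnW u1).
  by move/(_ isT) => H; rewrite -leqNgt (leq_trans H).
(* A neighbour is [e * (n %/ p)] with [e] dividing [p]; the choice [e = p] would give [n], so
   [n %/ p] is the only one. *)
have uv w : adj u w = (w == v).
  rewrite /= /pdg_adj -/p; have [w1 wn dw] := proper_divisorP w.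
  apply/andP/eqP => [[uw nuw]|->].
    apply/val_inj/val_inj; rewrite /= Ev.
    have cw : n %/ p %| val (val w) by rewrite -(dvdn_pmul2l (ltnW u1)) mulnC En.
    have c0 : 0 < n %/ p by rewrite divn_gt0 ?(ltnW u1) // dvdn_leq.
    have [e Ee] := dvdnP cw; have [_ pe] := primeP pu.
    have ep : e %| p by rewrite -(dvdn_pmul2r c0) -Ee (mulnC p) En.
    case/orP: (pe _ ep) => /eqP Ee1; first by rewrite Ee Ee1 mul1n.
    by move: wn; rewrite Ee Ee1 mulnC En ltnn.
  split; last by rewrite Ev mulnC En.
  apply: contra npp => /eqP E; rewrite -{1}En -Ev -E -/p; exact: dvdnn.
rewrite (big_pred1 v) //; have := degree_tau v.
rewrite Ev tau_divp // /exponent_code.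
suff -> : (n %| (n %/ p) ^ 2) = (1 < logn p n) by lia.
have c0 : 0 < n %/ p by rewrite divn_gt0 ?(ltnW u1) // dvdn_leq.
(* With [c = n %/ p], [c * p] divides [c * c] iff [p] divides [c], iff [p ^ 2] divides [n]. *)
rewrite -{1}En -mulnn dvdn_pmul2l // -(dvdn_pmul2r (ltnW u1)) En.
by rewrite mulnn pfactor_dvdn.
Qed.

Lemma perm_leaves :
  perm_eq [seq val (val u) | u <- enum (vertex (proper_divisor_graph n)) & degree u == 1]
    (primes n).
Proof.
apply: uniq_perm; last 1 first.
- move=> p; apply/mapP/idP => [[u]|pn].
    rewrite mem_filter leaf_prime => /andP[pu _] ->.
    by rewrite mem_primes pu n_gt0; have [] := proper_divisorP u.
  have [u Eu] := prime_vertex pn; exists u => //.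
  rewrite mem_filter leaf_prime Eu mem_enum andbT.
  by move: pn; rewrite mem_primes => /andP[].
- by rewrite map_inj_uniq 1?filter_uniq ?enum_uniq // => u v /val_inj/val_inj.
- exact: primes_uniq.
Qed.

End Leaves.

(** Stated for an arbitrary graph, so that it is visibly an isomorphism invariant up to order. At a
    vertex of degree one the sum is the degree of the only neighbour, obtained without choosing that
    neighbour. *)
Definition leaf_codes (G : sgraph) : seq nat :=
  [seq \sum_(v | adj u v) degree v | u <- enum (vertex G) & degree u == 1].

Lemma leaf_codes_exponents (n : nat) : 1 < n -> 5 < tau n ->
  perm_eq (leaf_codes (proper_divisor_graph n))
    [seq exponent_code (tau n) a | a <- unzip2 (prime_decomp n)].
Proof.
move=> n1 t5; have := perm_leaves n1 t5.
move/(perm_map (fun p => exponent_code (tau n) (logn p n))).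
rewrite -map_comp prime_decompE /unzip2 -!map_comp => H.
apply: perm_trans H; apply: (eq_ind _ (perm_eq _) (perm_refl _)); apply/eq_in_map => u /=.
rewrite mem_filter leaf_prime // => /andP[pu _].
by rewrite leaf_neighbor_degree.
Qed.

(** * Invariance under graph isomorphism *)

Section Isomorphism.

Variables (G H : sgraph) (f : vertex G -> vertex H).
Hypothesis f_bij : bijective f.
Hypothesis f_adj : forall u v, adj (f u) (f v) = adj u v.

Lemma iso_degree (u : vertex G) : degree (f u) = degree u.
Proof.
rewrite /degree -(card_imset _ (bij_inj f_bij)); apply: eq_card => w.
have [g fK gK] := f_bij; rewrite inE -[w]gK f_adj mem_imset ?inE //.
exact: bij_inj.
Qed.

Lemma iso_leaf_codes : perm_eq (leaf_codes G) (leaf_codes H).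
Proof.
have [g fK gK] := f_bij; have f_inj := bij_inj f_bij.
have E : perm_eq [seq u : vertex H <- enum (vertex H) | degree u == 1]
    (map f [seq u : vertex G <- enum (vertex G) | degree u == 1]).
  apply: uniq_perm; rewrite ?map_inj_uniq 1?filter_uniq ?enum_uniq //.
  by move=> w; rewrite -[w]gK mem_map // mem_filter mem_enum iso_degree mem_filter mem_enum.
rewrite perm_sym; apply: (perm_trans (perm_map _ E)).
rewrite -map_comp; apply: (eq_ind _ (perm_eq _) (perm_refl _)); apply: eq_map => u /=.
rewrite (reindex f) /=; last exact: onW_bij.
by apply: eq_big => v; rewrite ?f_adj ?iso_degree.
Qed.

End Isomorphism.

(** * Recovering the exponents from the codes *)

Lemma exponent_code_inj (T : nat) : 6 < T ->
  {in [pred a | 0 < a & a.+1 %| T] &, injective (exponent_code T)}.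
Proof.
move=> T6 a b; rewrite !inE /exponent_code => /andP[a0 aT] /andP[b0 bT].
move: (divnK aT) (divnK bT); set t := T %/ a.+1; set s := T %/ b.+1 => Et Es.
have t0 : 0 < t by move: Et; case: (t) => //; lia.
have s0 : 0 < s by move: Es; case: (s) => //; lia.
(* Exponents [1] and [c > 1] with equal codes have quotients [x = T / 2] and [y = T / (c + 1)] with
   [x = y + 1]. Then [y * (c - 1) = 2], so [T] is [4] or [6], against [6 < T]. *)
have key x y c : 1 < c -> 0 < y -> x * 2 = T -> y * c.+1 = T -> x = y + 1 -> False.
  move=> c1 y0 Ex Ey xy; have /eqP : y * (c - 1) = 2 by nia.
  case: y y0 Ex Ey xy => [|[|[|y]]] // _ Ex Ey xy; [lia|lia|].
  by case: c c1 Ey => [|[|c]] // _ Ey; rewrite mulSn; lia.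
have [a1|a1] := leqP a 1; have [b1|b1] := leqP b 1 => E; first lia.
- have Ea : a = 1 by lia.
  by case: (key t s b) => //; [rewrite -Et Ea | nia].
- have Eb : b = 1 by lia.
  by case: (key s t a) => //; [rewrite -Es Eb | nia].
(* For [a > 1] the code is [T - t - 2], so equal codes give equal quotients, hence equal
   exponents. *)
- have Ets : t = s by nia.
  by move: Et; rewrite -Es Ets => /eqP; rewrite eqn_pmul2l // => /eqP[].
Qed.

(** On [D], an entry [a] occurs as often as [f a] does in the image. The restriction to [D] suits
    the codes, which are compared only at positive [a] with [a.+1] dividing [tau n]. *)
Lemma perm_map_in_inj (A B : eqType) (D : {pred A}) (f : A -> B) (s t : seq A) :
  {in D &, injective f} -> {subset s <= D} -> {subset t <= D} ->
  perm_eq (map f s) (map f t) -> perm_eq s t.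
Proof.
move=> f_inj sD tD /permP H; apply/allP => a; rewrite mem_cat => ast.
have aD : a \in D by case/orP: ast; [exact: sD | exact: tD].
have E r : {subset r <= D} -> count_mem a r = count (pred1 (f a)) (map f r).
  move=> rD; rewrite count_map; apply: eq_in_count => x /rD xD /=.
  by rewrite (inj_in_eq f_inj).
by apply/eqP; rewrite /= !E.
Qed.

(** * Transport of divisors along a matching of primes *)

Lemma logn_prod (I : Type) (r : seq I) (F : I -> nat) (q : nat) :
  (forall i, 0 < F i) -> logn q (\prod_(i <- r) F i) = \sum_(i <- r) logn q (F i).
Proof.
move=> F0; elim: r => [|i r IH]; first by rewrite !big_nil logn1.
by rewrite !big_cons lognM ?IH ?prodn_gt0.
Qed.

Section Transport.

Variable k : nat.

(** For distinct primes [P i], the multiplicative map on positive integers that replaces each [P i]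
    by [Q i] and drops all other prime factors. *)
Definition transport (P Q : 'I_k -> nat) (d : nat) : nat :=
  \prod_i Q i ^ logn (P i) d.

Lemma logn_prime_prod (Q : 'I_k -> nat) (e : 'I_k -> nat) (i : 'I_k) :
  injective Q -> (forall i, prime (Q i)) -> logn (Q i) (\prod_j Q j ^ e j) = e i.
Proof.
move=> Q_inj Q_prime.
rewrite logn_prod => [|j]; last by rewrite expn_gt0 prime_gt0.
rewrite (bigD1 i) //= big1 => [|j ji]; first by rewrite lognX logn_prime // eqxx muln1 addn0.
by rewrite lognX logn_prime // (inj_eq Q_inj) eq_sym (negbTE ji) muln0.
Qed.

Lemma logn_prime_prod0 (Q : 'I_k -> nat) (e : 'I_k -> nat) (q : nat) :
  (forall i, prime (Q i)) -> prime q -> (forall i, q != Q i) ->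
  logn q (\prod_j Q j ^ e j) = 0.
Proof.
move=> Q_prime pq Nq; rewrite logn_prod => [|j]; last by rewrite expn_gt0 prime_gt0.
by rewrite big1 // => j _; rewrite lognX logn_prime // (negbTE (Nq j)) muln0.
Qed.

Variables P Q : 'I_k -> nat.
Hypotheses (P_inj : injective P) (P_prime : forall i, prime (P i)).
Hypotheses (Q_inj : injective Q) (Q_prime : forall i, prime (Q i)).

Lemma transport_gt0 (d : nat) : 0 < transport P Q d.
Proof. by rewrite prodn_gt0 // => i; rewrite expn_gt0 prime_gt0. Qed.

Lemma transport1 : transport P Q 1 = 1.
Proof. by rewrite /transport big1 // => i _; rewrite logn1. Qed.

Lemma transportM (d e : nat) : 0 < d -> 0 < e ->
  transport P Q (d * e) = transport P Q d * transport P Q e.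
Proof.
move=> d0 e0; rewrite /transport -big_split; apply: eq_bigr => i _ /=.
by rewrite lognM // expnD.
Qed.

Lemma transport_dvd (d n : nat) : 0 < n -> d %| n ->
  transport P Q d %| transport P Q n.
Proof.
move=> n0 /dvdnP[c En]; move: n0; rewrite En muln_gt0 => /andP[c0 d0].
by rewrite transportM // dvdn_mull.
Qed.

Lemma transport_prod (e : 'I_k -> nat) :
  transport P Q (\prod_i P i ^ e i) = \prod_i Q i ^ e i.
Proof. by apply: eq_bigr => i _; rewrite logn_prime_prod. Qed.

(** Valuations are compared prime by prime. At [P i] both equal [logn (P i) d]; at any other prime
    the left one vanishes by construction and the right one by the assumption on [d]. *)
Lemma transportK (d : nat) : 0 < d ->
  (forall p, prime p -> p %| d -> exists i, p = P i) ->
  transport Q P (transport P Q d) = d.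
Proof.
move=> d0 dP; apply: eqn_from_log => //.
  by rewrite prodn_gt0 // => i; rewrite expn_gt0 prime_gt0.
move=> p; have [pp|np] := boolP (prime p); last first.
  have L x : logn p x = 0 by rewrite lognE (negbTE np).
  by rewrite !L.
have [/existsP[i /eqP ->]|/existsPn Np] := boolP [exists i, p == P i].
  by rewrite /transport !logn_prime_prod.
rewrite logn_prime_prod0 //; apply/esym/eqP; rewrite -leqn0 leqNgt logn_gt0 mem_primes.
apply/negP => /and3P[_ _ pd]; have [i Ei] := dP _ pp pd.
by move: (Np i); rewrite Ei eqxx.
Qed.

End Transport.

(** Supplies, for divisors of the product, the condition under which [transportK] inverts the
    transport. *)
Lemma prime_dvd_prod (k : nat) (P e : 'I_k -> nat) (d p : nat) :
  (forall i, prime (P i)) -> d %| \prod_i P i ^ e i -> prime p -> p %| d ->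
  exists i, p = P i.
Proof.
move=> P_prime dn pp pd.
have [/existsP[i /eqP ->]|/existsPn Np] := boolP [exists i, p == P i]; first by exists i.
have: 0 < logn p (\prod_i P i ^ e i).
  rewrite logn_gt0 mem_primes pp (dvdn_trans pd dn) prodn_gt0 // => i.
  by rewrite expn_gt0 prime_gt0.
by rewrite logn_prime_prod0.
Qed.

Lemma transport_vertex (k : nat) (P Q e : 'I_k -> nat) (m n : nat) :
  injective P -> (forall i, prime (P i)) -> injective Q -> (forall i, prime (Q i)) ->
  m = \prod_i P i ^ e i -> n = \prod_i Q i ^ e i ->
  exists f : vertex (proper_divisor_graph m) -> vertex (proper_divisor_graph n),
    forall u, val (val (f u)) = transport P Q (val (val u)).
Proof.
move=> P_inj P_prime Q_inj Q_prime Em En.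
apply: (fin_all_exists (P := fun u (v : vertex (proper_divisor_graph n)) =>
  val (val v) = transport P Q (val (val u)))) => u.
have [u1 um du] := proper_divisorP u; set d := val (val u) in u1 um du *.
have m0 : 0 < m by apply: leq_trans um.
have d0 : 0 < d by apply: ltnW.
have Tm : transport P Q m = n by rewrite Em En transport_prod.
have dK : transport Q P (transport P Q d) = d.
  by apply: transportK => // p; apply: (prime_dvd_prod (e := e)) => //; rewrite -Em; exact: du.
have Tdvd : transport P Q d %| n by rewrite -Tm transport_dvd.
(* The image is neither [1] nor [n]: the inverse transport would carry these back to [1] and [m],
   which are not proper divisors of [m]. *)
apply: vertex_of_divisor => //.
  rewrite ltn_neqAle transport_gt0 // andbT eq_sym.
  by apply: contraTneq u1 => Td; rewrite -dK Td transport1.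
rewrite ltn_neqAle dvdn_leq // ?andbT; last by rewrite -Tm transport_gt0.
apply: contraTneq um => Td.
by rewrite -dK Td En transport_prod // -Em ltnn.
Qed.

Lemma iso_of_factorizations (k : nat) (P Q e : 'I_k -> nat) (m n : nat) :
  injective P -> (forall i, prime (P i)) -> injective Q -> (forall i, prime (Q i)) ->
  m = \prod_i P i ^ e i -> n = \prod_i Q i ^ e i ->
  graph_iso (proper_divisor_graph m) (proper_divisor_graph n).
Proof.
move=> P_inj P_prime Q_inj Q_prime Em En.
have [f fE] := transport_vertex P_inj P_prime Q_inj Q_prime Em En.
have [g gE] := transport_vertex Q_inj Q_prime P_inj P_prime En Em.
have fK : cancel f g.
  move=> u; have [u1 um du] := proper_divisorP u.
  apply/val_inj/val_inj; rewrite /= gE fE transportK ?(ltnW u1) //.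
  by move=> p; apply: (prime_dvd_prod (e := e)) => //; rewrite -Em; exact: du.
have gK : cancel g f.
  move=> u; have [u1 um du] := proper_divisorP u.
  apply/val_inj/val_inj; rewrite /= fE gE transportK ?(ltnW u1) //.
  by move=> p; apply: (prime_dvd_prod (e := e)) => //; rewrite -En; exact: du.
have [f_bij g_bij] : bijective f /\ bijective g by split; [exists g | exists f].
exists f; split=> // u v; rewrite /= /pdg_adj (bij_eq f_bij); congr (_ && _).
have Tm : transport P Q m = n by rewrite Em En transport_prod.
have Tn : transport Q P n = m by rewrite Em En transport_prod.
have [u1 um du] := proper_divisorP u; have [v1 vm dv] := proper_divisorP v.
have [fu1 _ _] := proper_divisorP (f u); have [fv1 _ _] := proper_divisorP (f v).
have u0 := ltnW u1; have v0 := ltnW v1; have fu0 := ltnW fu1; have fv0 := ltnW fv1.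
(* Transport is multiplicative, preserves divisibility and exchanges [m] with [n], so each
   divisibility is the transport of the other. *)
apply/idP/idP => [H|H].
  rewrite -[u]fK -[v]fK !gE -transportM // -Tn transport_dvd //.
  by rewrite muln_gt0 fu0.
by rewrite !fE -transportM // -Tm transport_dvd // muln_gt0 u0.
Qed.

Lemma iso_of_similar (m n : nat) : similar m n ->
  graph_iso (proper_divisor_graph m) (proper_divisor_graph n).
Proof.
case=> s [t [[us ps _ _ Em] [ut pt _ _ En] st]].
have sz : size t = size s by rewrite -(size_map snd) -[map _ _]st size_map.
(* Primes are matched by their position in the two lists; the common exponent list makes this
   matching preserve exponents. *)
pose P (i : 'I_(size s)) := nth 0 (unzip1 s) i.
pose Q (i : 'I_(size s)) := nth 0 (unzip1 t) i.
have [Ps Qs] : (forall i : 'I_(size s), i < size (unzip1 s)) /\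
    (forall i : 'I_(size s), i < size (unzip1 t)).
  by split=> i; rewrite size_map ?sz.
apply: (@iso_of_factorizations _ P Q (fun i => nth 0 (unzip2 s) i)).
- by move=> i j /eqP; rewrite nth_uniq // => /eqP/val_inj.
- by move=> i; apply: (allP ps); rewrite mem_nth.
- by move=> i j /eqP; rewrite nth_uniq // => /eqP/val_inj.
- by move=> i; apply: (allP pt); rewrite mem_nth.
- rewrite Em (big_nth (0, 0)) big_mkord; apply: eq_bigr => i _.
  by rewrite /P !(nth_map (0, 0)).
- rewrite En (big_nth (0, 0)) big_mkord sz; apply: eq_bigr => i _.
  by rewrite /Q st !(nth_map (0, 0)) ?sz.
Qed.

(** * Similarity in terms of the multiset of exponents *)

Lemma geq_total : total geq.
Proof. by move=> a b; apply: leq_total. Qed.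

Lemma sorted_factorization (n : nat) : 0 < n ->
  exists2 s, ordered_factorization n s &
    unzip2 s = sort geq (unzip2 (prime_decomp n)).
Proof.
move=> n0; pose s := sort (relpre snd geq) (prime_decomp n).
have ps : perm_eq s (prime_decomp n) by rewrite perm_sort.
have ps1 : perm_eq (unzip1 s) (primes n) by exact: perm_map.
have ps2 : unzip2 s = sort geq (unzip2 (prime_decomp n)) by rewrite [RHS]sort_map.
exists s => //; split.
- by rewrite (perm_uniq ps1) primes_uniq.
- by rewrite (perm_all _ ps1); apply/allP => p; rewrite mem_primes => /andP[].
- by rewrite ps2; apply/sort_sorted/geq_total.
- rewrite (perm_all _ (perm_map snd ps)) all_map; apply/allP => [[p e]].
  by case/mem_prime_decomp.
- by rewrite (perm_big _ ps) -prod_prime_decomp.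
Qed.

(** Sorting two permutations of one list by the total order [geq] yields the same list, which serves
    as the common exponent list. *)
Lemma similar_of_perm (m n : nat) : 0 < m -> 0 < n ->
  perm_eq (unzip2 (prime_decomp m)) (unzip2 (prime_decomp n)) -> similar m n.
Proof.
move=> m0 n0 mn.
have [s fs Es] := sorted_factorization m0; have [t ft Et] := sorted_factorization n0.
exists s, t; split=> //; rewrite Es Et; apply/perm_sortP => //.
- exact: geq_total.
- by move=> y x z; rewrite /geq /= => yx zy; apply: leq_trans yx.
- by move=> x y /andP[xy yx]; apply/eqP; rewrite eqn_leq [x <= y]yx [y <= x]xy.
Qed.

(** * Few divisors, and the passage from isomorphism to exponents *)

Lemma exponents_gt0 (n a : nat) : a \in unzip2 (prime_decomp n) -> 0 < a.
Proof. by case/mapP=> [[p e]] /mem_prime_decomp[_ e0 _] ->. Qed.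

Lemma exponents_dvd_tau (n a : nat) : 0 < n ->
  a \in unzip2 (prime_decomp n) -> a.+1 %| tau n.
Proof.
move=> n0; rewrite prime_decompE => /mapP[_ /mapP[p pn ->] ->] /=.
move: pn; rewrite mem_primes => /andP[pp _].
by rewrite (tau_logn n0 pp) dvdn_mulr.
Qed.

(* A product of three factors [a.+1] with [a > 0] is at least [8]. *)
Lemma small_exponents (s : seq nat) : {in s, forall a, 0 < a} ->
  1 < \prod_(a <- s) a.+1 < 8 ->
  s = [:: (\prod_(a <- s) a.+1).-1] \/
  exists a b, [/\ s = [:: a; b], 0 < a, 0 < b & \prod_(a <- s) a.+1 = a.+1 * b.+1].
Proof.
case: s => [|a [|b [|c s]]] s0; rewrite ?big_nil ?big_cons ?muln1.
- by [].
- by rewrite big_nil muln1; left.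
- rewrite big_nil muln1 => _; right; exists a, b; split=> //; apply: s0.
    by rewrite mem_head.
  by rewrite !inE eqxx orbT.
have [a0 [b0 c0]] : 0 < a /\ 0 < b /\ 0 < c.
  by split; [|split]; apply: s0; rewrite !inE eqxx ?orbT.
have: 0 < \prod_(j <- s) j.+1 by rewrite prodn_gt0.
move: (\prod_(j <- s) _) => x; nia.
Qed.

Lemma prod_exponents1 (n a : nat) : 0 < n -> unzip2 (prime_decomp n) = [:: a] ->
  exists2 p, prime p & n = p ^ a.
Proof.
move=> n0; have := prod_prime_decomp n0; have := @mem_prime_decomp n.
case: (prime_decomp n) => [|[p e] [|x s]] //= H; rewrite big_seq1 => -> [<-].
by exists p => //; case: (H p e); rewrite ?mem_head.
Qed.

Lemma prod_exponents2 (n a b : nat) : 0 < n ->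
  unzip2 (prime_decomp n) = [:: a; b] ->
  exists p q, [/\ prime p, prime q, p <> q & n = p ^ a * q ^ b].
Proof.
move=> n0; have := prod_prime_decomp n0; have := @mem_prime_decomp n.
have: uniq (unzip1 (prime_decomp n)) by exact: primes_uniq.
case: (prime_decomp n) => [|[p e] [|[q f] [|x s]]] //=.
rewrite !big_cons big_nil muln1 /= inE andbT => pq H -> [<- <-].
exists p, q; split=> //; last exact/eqP.
- by case: (H p e); rewrite ?mem_head.
- by case: (H q f); rewrite ?inE ?eqxx ?orbT.
Qed.

Lemma exceptional_sym (m n : nat) : exceptional_pair m n -> exceptional_pair n m.
Proof. by case=> p [q1 [q2 [pp p1 p2 Nq H]]]; exists p, q1, q2; split=> //; tauto. Qed.

Lemma exceptional_of_exponents (m n : nat) : 0 < m -> 0 < n ->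
  unzip2 (prime_decomp m) = [:: 3] -> unzip2 (prime_decomp n) = [:: 1; 1] ->
  exceptional_pair m n.
Proof.
move=> m0 n0 /(prod_exponents1 m0)[p pp Em] /(prod_exponents2 n0)[q1 [q2 [p1 p2 Nq En]]].
by exists p, q1, q2; split=> //; left; rewrite En !expn1.
Qed.

Lemma similar_or_exceptional (m n : nat) : composite m -> composite n ->
  graph_iso (proper_divisor_graph m) (proper_divisor_graph n) ->
  similar m n \/ exceptional_pair m n.
Proof.
move=> cm cn [f [f_bij f_adj]].
have [m1 n1] := (composite_gt1 cm, composite_gt1 cn).
have [m0 n0] := (ltnW m1, ltnW n1).
have Tmn : tau m = tau n by rewrite !card_vertices //; congr _.+2; exact: bij_eq_card f_bij.
have T2 := composite_tau cn.
have codes : 5 < tau n -> perm_eq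
    [seq exponent_code (tau n) a | a <- unzip2 (prime_decomp m)]
    [seq exponent_code (tau n) a | a <- unzip2 (prime_decomp n)].
  move=> T5; have Hm : 5 < tau m by rewrite Tmn.
  have := leaf_codes_exponents m1 Hm; rewrite Tmn perm_sym => /perm_trans; apply.
  apply: perm_trans (iso_leaf_codes f_bij f_adj) _; exact: leaf_codes_exponents.
have [T6|T6] := ltnP 6 (tau n).
  left; apply: similar_of_perm => //.
  apply: perm_map_in_inj (exponent_code_inj T6) _ _ (codes (ltnW T6)) => a sa.
    by rewrite inE (exponents_gt0 sa) -Tmn exponents_dvd_tau.
  by rewrite inE (exponents_gt0 sa) exponents_dvd_tau.
(* The number of vertices of degree one is the number of prime factors; this separates exponents [5]
   and [1, 2] when [tau n = 6]. *)
have sz : 5 < tau n -> size (unzip2 (prime_decomp m)) = size (unzip2 (prime_decomp n)).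
  by move=> /codes/perm_size; rewrite !size_map.
have := small_exponents (@exponents_gt0 m); rewrite -tau_exponents // Tmn => /(_ _) Hm.
have := small_exponents (@exponents_gt0 n); rewrite -tau_exponents // => /(_ _) Hn.
have bT : 1 < tau n < 8 by apply/andP; split; lia.
(* At most [6], a product of two factors that are at least [2] is [2 * 2], [2 * 3] or [3 * 2]. *)
have pairs a b : 0 < a -> 0 < b -> tau n = a.+1 * b.+1 ->
    [\/ [/\ tau n = 4, a = 1 & b = 1], [/\ tau n = 6, a = 1 & b = 2] |
        [/\ tau n = 6, a = 2 & b = 1]].
  move=> a0 b0 E; have [a3 b3] : a < 3 /\ b < 3 by nia.
  case: a a0 a3 E => [|[|[|a]]] // _ _; case: b b0 b3 => [|[|[|b]]] // _ _ E.
  - by constructor 1.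
  - by constructor 2.
  - by constructor 3.
  - by move: T6; rewrite E.
case: (Hm bT) (Hn bT) => [Em|[a [b [Em a0 b0 Eab]]]] [En|[c [d [En c0 d0 Ecd]]]].
(* Both numbers are prime powers, with the same exponent [(tau n).-1]. *)
- by left; apply: similar_of_perm; rewrite // Em En.
- case: (pairs _ _ c0 d0 Ecd) => [[T4 Ec Ed]|[T _ _]|[T _ _]].
  + by right; apply: exceptional_of_exponents; rewrite // ?Em ?En ?T4 ?Ec ?Ed.
  + by move: sz; rewrite Em En T => /(_ isT).
  + by move: sz; rewrite Em En T => /(_ isT).
- case: (pairs _ _ a0 b0 Eab) => [[T4 Ea Eb]|[T _ _]|[T _ _]].
  + by right; apply/exceptional_sym/exceptional_of_exponents; rewrite // ?Em ?En ?T4 ?Ea ?Eb.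
  + by move: sz; rewrite Em En T => /(_ isT).
  + by move: sz; rewrite Em En T => /(_ isT).
(* With two primes on each side the exponents are [1, 1] or [1, 2] in some order; [tau n] being [4]
   or [6] decides which. *)
left; apply: similar_of_perm; rewrite // Em En.
case: (pairs _ _ c0 d0 Ecd) => [[T -> ->]|[T -> ->]|[T -> ->]];
  case: (pairs _ _ a0 b0 Eab) => [[T' -> ->]|[T' -> ->]|[T' -> ->]] //;
  by move: T'; rewrite T.
Qed.

(** * The exceptional pair *)

Lemma graph_iso_sym (G H : sgraph) : graph_iso G H -> graph_iso H G.
Proof.
case=> f [[g fK gK] f_adj]; exists g; split; first by exists f.
by move=> u v; rewrite -f_adj !gK.
Qed.

Lemma complete_graph_iso (G H : sgraph) : #|vertex G| = #|vertex H| ->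
  (forall u v : vertex G, adj u v = (u != v)) ->
  (forall u v : vertex H, adj u v = (u != v)) -> graph_iso G H.
Proof.
move=> E aG aH.
pose f u := enum_val (cast_ord E (enum_rank u)).
pose g v := enum_val (cast_ord (esym E) (enum_rank v)).
have fK : cancel f g by move=> u; rewrite /f /g enum_valK cast_ordK enum_rankK.
have gK : cancel g f by move=> u; rewrite /f /g enum_valK cast_ordKV enum_rankK.
exists f; split; first by exists g.
by move=> u v; rewrite aG aH (can_eq fK).
Qed.

(** Distinct exponents that are at least [1] sum to at least [3]. *)
Lemma cube_adj (p : nat) (u v : vertex (proper_divisor_graph (p ^ 3))) :
  prime p -> adj u v = (u != v).
Proof.
move=> pp; rewrite /= /pdg_adj; have [//|uv] /= := eqVneq u v.
have [u1 un /(dvdn_pfactor _ _ pp)[i i3 Ei]] := proper_divisorP u.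
have [v1 vn /(dvdn_pfactor _ _ pp)[j j3 Ej]] := proper_divisorP v.
have: i != j.
  by apply: contraNneq uv => ij; apply/eqP/val_inj/val_inj; rewrite /= Ei Ej ij.
have i0 : 0 < i by move: u1; rewrite Ei; case: (i).
have j0 : 0 < j by move: v1; rewrite Ej; case: (j).
move=> ij; rewrite Ei Ej -expnD dvdn_exp2l //; lia.
Qed.

(** If [p] divides [u], the cofactor divides [q] and is not [q], as [u < p * q]; otherwise [u] is
    coprime to [p] and divides [q]. *)
Lemma semiprime_vertex (p q : nat) (u : vertex (proper_divisor_graph (p * q))) :
  prime p -> prime q -> val (val u) = p \/ val (val u) = q.
Proof.
move=> pp pq; have [u1 un du] := proper_divisorP u.
have [p0 q0] := (prime_gt0 pp, prime_gt0 pq).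
have [_ dp] := primeP pp; have [_ dq] := primeP pq.
have [pu|Npu] := boolP (p %| val (val u)).
  have [c Ec] := dvdnP pu; move: un du; rewrite Ec mulnC => un du.
  rewrite dvdn_pmul2l // in du; left.
  case/orP: (dq _ du) => /eqP Ec1; first by rewrite Ec1 muln1.
  by move: un; rewrite Ec1 ltnn.
right; move: du; rewrite Gauss_dvdr; last by rewrite coprime_sym prime_coprime.
by case/dq/orP => /eqP // E; move: u1; rewrite E.
Qed.

Lemma semiprime_adj (p q : nat) (u v : vertex (proper_divisor_graph (p * q))) :
  prime p -> prime q -> adj u v = (u != v).
Proof.
move=> pp pq; rewrite /= /pdg_adj; have [//|uv] /= := eqVneq u v.
have Nuv : val (val u) <> val (val v) by move=> E; case/eqP: uv; apply/val_inj/val_inj.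
case: (semiprime_vertex u pp pq) (semiprime_vertex v pp pq) => Eu [] Ev.
- by case: Nuv; rewrite Eu Ev.
- by rewrite Eu Ev dvdnn.
- by rewrite Eu Ev mulnC dvdnn.
- by case: Nuv; rewrite Eu Ev.
Qed.

(** Both graphs are complete on two vertices, since [tau] is [4] on either side. *)
Lemma exceptional_iso (m n : nat) : exceptional_pair m n ->
  graph_iso (proper_divisor_graph m) (proper_divisor_graph n).
Proof.
case=> p [q1 [q2 [pp p1 p2 /eqP Nq H]]].
suff E : graph_iso (proper_divisor_graph (p ^ 3)) (proper_divisor_graph (q1 * q2)).
  by case: H => [[-> ->] //|[-> ->]]; exact: graph_iso_sym.
have [q1_gt1 q2_gt1] := (prime_gt1 p1, prime_gt1 p2).
apply: complete_graph_iso.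
- apply: succn_inj; apply: succn_inj; rewrite -!card_vertices ?tau_pfactor //.
  + rewrite tau_coprime ?tau_prime ?prime_gt0 //.
    by rewrite prime_coprime // dvdn_prime2.
  + by rewrite (leq_trans q1_gt1) // leq_pmulr // ltnW.
  + by rewrite -{1}(exp1n 3) ltn_exp2r // prime_gt1.
- by move=> u v; exact: cube_adj.
- by move=> u v; exact: semiprime_adj.
Qed.

(** Makes the length of an ordered factorization depend on [n] alone, so that similar numbers have
    equally many prime factors; this tells [p ^ 3] from [q1 * q2]. *)
Lemma factorization_primes (n : nat) (s : seq (nat * nat)) :
  ordered_factorization n s -> perm_eq (unzip1 s) (primes n).
Proof.
case=> us /allP ps _ /allP es ->; apply: uniq_perm; rewrite ?primes_uniq //.
elim: s us ps es => [|[p e] s IH] /=.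
  by move=> _ _ _ q; rewrite big_nil.
case/andP=> _ us ps es q; rewrite big_cons primesM ?expn_gt0 /=.
- rewrite primesX; last by apply: es; rewrite mem_head.
  rewrite primes_prime; last by apply: ps; rewrite mem_head.
  by rewrite !inE IH // => x xs; [apply: ps | apply: es]; rewrite inE xs orbT.
- by rewrite prime_gt0 // ps // mem_head.
- rewrite big_seq prodn_cond_gt0 // => [[r f]] rs.
  rewrite expn_gt0 prime_gt0 // ps // inE; apply/orP; right.
  by apply/mapP; exists (r, f).
Qed.

Lemma similar_size_primes (m n : nat) : similar m n ->
  size (primes m) = size (primes n).
Proof.
case=> s [t [/factorization_primes/perm_size <- /factorization_primes/perm_size <- E]].
by rewrite !size_map -(size_map snd s) -(size_map snd t) [map _ s]E.
Qed.

Lemma exceptional_not_similar (m n : nat) : exceptional_pair m n -> ~ similar m n.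
Proof.
case=> p [q1 [q2 [pp p1 p2 /eqP Nq H]]] /similar_size_primes.
have E1 : size (primes (p ^ 3)) = 1 by rewrite primesX // primes_prime.
suff E2 : size (primes (q1 * q2)) = 2 by case: H => [[-> ->]|[-> ->]]; rewrite E1 E2.
have /perm_size : perm_eq (primes (q1 * q2)) [:: q1; q2].
  apply: uniq_perm; rewrite ?primes_uniq //= ?inE ?andbT // => q.
  by rewrite primesM ?prime_gt0 // !primes_prime // !inE.
by [].
Qed.

Theorem theorem3p1 (m n : nat) (hm : composite m) (hn : composite n) :
  (graph_iso (proper_divisor_graph m) (proper_divisor_graph n) <->
     similar m n \/ exceptional_pair m n) /\
  (exceptional_pair m n ->
     graph_iso (proper_divisor_graph m) (proper_divisor_graph n) /\
     ~ similar m n).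
Proof.
split; last first.
  by move=> ex; split; [exact: exceptional_iso | exact: exceptional_not_similar].
split; first exact: similar_or_exceptional.
by case; [exact: iso_of_similar | exact: exceptional_iso].
Qed.
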